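(* Let $m$ be a positive integer such that $m^2+4$ is square-free. Then $h(m^2+4)=1$ if and only if either $m=1$, or $m=p$ for some prime $p$ such that $1+pt-t^2$ is a prime number for every integer $t$ with $1\le t\le \frac{p-1}{2}$.
   Context: For a square-free integer $d>1$, $h(d)$ denotes the class number of the real quadratic field $\mathbb{Q}(\sqrt d)$. *)

(* Defs.v *)
From HB Require Import structures.
From mathcomp Require Import all_boot all_order all_algebra all_field.
From mathcomp Require Import finmap.
From mathcomp Require Import boolp classical_sets functions cardinality.

Set Implicit Arguments.
Unset Strict Implicit.
Unset Printing Implicit Defensive.

Import Order.TTheory GRing.Theory Num.Theory.
Local Open Scope classical_set_scope.
Local Open Scope ring_scope.

Definition square_free (n : nat) : Prop :=
  forall k : nat, (k ^ 2 %| n)%N -> k = 1%N.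

(* Number fields are realised as subfields of the algebraic numbers [algC],
   given by their underlying sets. *)
Definition quadratic_field (d : nat) : set algC :=
  [set x | exists a b : rat, x = ratr a + ratr b * sqrtC d%:R].

Definition ring_of_integers (K : set algC) : set algC :=
  [set x | K x /\ x \in Aint].

Record fractional_ideal (K : set algC) (I : set algC) : Prop := {
  fractional_ideal_sub : I `<=` K;
  fractional_ideal_neq0 : exists2 x, I x & x != 0;
  fractional_ideal_add : forall x y, I x -> I y -> I (x + y);
  fractional_ideal_mul :
    forall a x, ring_of_integers K a -> I x -> I (a * x);
  fractional_ideal_denom :
    exists c, [/\ ring_of_integers K c, c != 0
                & forall x, I x -> ring_of_integers K (c * x)]
}.

(* The coset of [I] modulo the principal fractional ideals: since
   [(x) * I = x I], it consists of the ideals [x I] with [x] in [K^*]. *)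
Definition ideal_class (K : set algC) (I : set algC) : set (set algC) :=
  [set [set x * y | y in I] | x in [set x | K x /\ x != 0]].

Definition class_group (K : set algC) : set (set (set algC)) :=
  [set ideal_class K I | I in fractional_ideal K].

(* [fset_set] sends an infinite set to the empty one; the class group of a
   number field is finite, so this default value does not occur. *)
Definition class_number (K : set algC) : nat :=
  #|` fset_set (class_group K)|%fset.

Definition h (d : nat) : nat := class_number (quadratic_field d).

(* Main.v *)
Require Import Defs.
From mathcomp Require Import all_boot all_order all_algebra all_field.
From mathcomp Require Import finmap boolp classical_sets cardinality.
From mathcomp Require Import ring lra zify.

Import Order.TTheory GRing.Theory Num.Theory.
Local Open Scope ring_scope.

(* Write e = (m + sqrt(m^2+4)) / 2, so e^2 = m e + 1, the ring of integers is
   Z + Z e, the norm of x + y e is x^2 + m x y - y^2, and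
   f(t) := 1 + m t - t^2 = - N(t - e).

   If every ideal is principal, a prime q dividing f(t) is, up to sign, the norm
   of a generator of the ideal (q, t - e).  Multiplying by powers of the unit e
   (a descent on the coordinates) shows that a prime norm is at least m, whereas
   f(t) < m^2 for 1 <= t <= (m-1)/2; so f(t) has no prime factor at most its
   square root.  In particular m = f(1) is prime.

   Conversely, divide an ideal by an element x of minimal norm; this gives a
   lattice J containing 1 whose nonzero elements have norm at least 1 in
   absolute value.  If J is not the ring of integers, it contains some
   (b - e) / q with q prime, and b can be translated so that |2b - m| <= q.
   Then q divides f(b) and f(b) >= q^2, so q < m; as f(b) = f(m - b), f(b) is
   one of the prime values, a contradiction. *)

(** * The norm form and a lower bound for prime norms *)

Definition qnorm (R : comNzRingType) (m : nat) (x y : R) : R :=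
  x ^+ 2 + m%:R * x * y - y ^+ 2.
Arguments qnorm {R} m x y.

Lemma prime_neq_sqr (q k : nat) : prime q -> q <> (k ^ 2)%N.
Proof.
move=> q_pr qE; have : (k %| q)%N by rewrite qE dvdn_mulr.
have q_gt1 := prime_gt1 q_pr.
by case/primeP: q_pr => _ + /[dup] kq => /[apply] /orP[] /eqP; nia.
Qed.

(** Descent by the unit: for [y = m x + z] one has [x + y e = e (z + x e)], and the norm changes
    sign. It ends when a coordinate vanishes, where the norm is a square up to sign, or when
    [y < m x]. *)
Lemma qnorm_nat_prime_ge (m x y q : nat) :
  prime q -> qnorm m x%:Z y%:Z = q%:Z \/ qnorm m x%:Z y%:Z = - q%:Z ->
  (m <= q)%N.
Proof.
move=> q_pr; have q_gt0 := prime_gt0 q_pr.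
have [n] := ubnP (x + y)%N; elim: n x y => // n IHn x y ltxyn.
rewrite /qnorm; have [->|y_gt0] := posnP y.
  rewrite mulr0 expr0n /= subr0 addr0 => Nx.
  by case: (@prime_neq_sqr q x q_pr); case: Nx; rewrite -mulnn expr2; lia.
have [->|x_gt0] := posnP x.
  rewrite mulr0 mul0r expr0n /= !add0r => Ny.
  by case: (@prime_neq_sqr q y q_pr); case: Ny; rewrite -mulnn expr2; lia.
have [le_mx|lt_mx] := leqP (m * x) y; last first.
  (* Two positive integers of sum [m * x] have product at least [m * x - 1], so the norm is at least
     [x^2 + m x - 1 >= m]. *)
  have : (m * x - 1 <= y * (m * x - y))%N by nia.
  by move=> ? [] ?; nia.
have [z Dy] : exists z, y = (m * x + z)%N by exists (y - m * x)%N; lia.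
have [m0|m_gt0] := posnP m; first by rewrite m0.
move=> Nxy; apply: (IHn z x); first by nia.
have -> : qnorm m z%:Z x%:Z = - qnorm m x%:Z y%:Z.
  by rewrite Dy /qnorm PoszD PoszM; ring.
by rewrite /qnorm; case: Nxy => ->; [right|left; rewrite opprK].
Qed.

(** If [x * y >= 0], absolute values do not change the form; otherwise its value at [|y|, |x|] is
    the opposite of that at [x, y]. *)
Lemma qnorm_prime_ge (m q : nat) (x y : int) :
  prime q -> qnorm m x y = q%:Z \/ qnorm m x y = - q%:Z -> (m <= q)%N.
Proof.
move=> q_pr Nxy.
have [sxy|sxy] := lerP 0 (x * y).
  apply: (@qnorm_nat_prime_ge m `|x| `|y| q q_pr).
  rewrite /qnorm !abszE -!normrX.
  have -> : m%:R * `|x| * `|y| = m%:R * x * y :> int.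
    by rewrite -mulrA -normrM ger0_norm ?mulrA.
  by rewrite !ger0_norm ?sqr_ge0.
apply: (@qnorm_nat_prime_ge m `|y| `|x| q q_pr).
rewrite /qnorm !abszE -!normrX.
have -> : m%:R * `|y| * `|x| = - (m%:R * x * y) :> int.
  by rewrite -mulrA -normrM mulrC ltr0_norm 1?mulrC //; ring.
rewrite !ger0_norm ?sqr_ge0 //.
have -> : y ^+ 2 + - (m%:R * x * y) - x ^+ 2 = - qnorm m x y.
  by rewrite /qnorm; ring.
by case: Nxy => ->; [right|left; rewrite opprK].
Qed.

(** * Lattices stable under [e] with no nonzero norm below 1 in absolute value *)

Lemma coprimez_prime (q : nat) (u : int) :
  prime q -> ~~ (q %| u)%Z -> exists a b : int, a * u + b * q%:Z = 1.
Proof.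
move=> q_pr; rewrite dvdzE /= -prime_coprime // => cop.
have /coprimezP[[a b] /= <-] : coprimez u q by rewrite coprimezE coprime_sym.
by exists a, b.
Qed.

(** [J] is a lattice in the coordinates on [1, e], and [Jeps] is its stability under [e]. If [q]
    divides [v], subtracting an integer multiple of [e] leaves [u / q]; were it not an integer, [J]
    would contain [1 / q], of norm below 1. Otherwise [J] contains some [(b - e) / q], which [nob]
    excludes. *)
Lemma lattice_prime_denominator (m : nat) (J : rat -> rat -> Prop)
    (J1 : J 1 0)
    (JD : forall x y x' y', J x y -> J x' y' -> J (x + x') (y + y'))
    (JZ : forall (n : int) x y, J x y -> J (n%:~R * x) (n%:~R * y))
    (Jeps : forall x y, J x y -> J y (x + m%:R * y))
    (Jnorm : forall x y, J x y -> (x != 0) || (y != 0) ->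
       1 <= `|qnorm m x y|)
    (nob : forall (q : nat) (b : int), prime q -> `|2 * b - m%:Z| <= q%:Z ->
       (q %| 1 + m%:Z * b - b ^+ 2)%Z ->
       q%:Z ^+ 2 <= 1 + m%:Z * b - b ^+ 2 -> False)
    (q : nat) (u v : int) :
  prime q -> J (u%:~R / q%:R) (v%:~R / q%:R) -> (q %| u)%Z && (q %| v)%Z.
Proof.
move=> q_pr Juv; have q_gt1 := prime_gt1 q_pr.
have q_neq0 : q%:R != 0 :> rat by rewrite pnatr_eq0; lia.
have J01 : J 0 1 by have := Jeps _ _ J1; rewrite mulr0 addr0.
have Jint (a b : int) : J a%:~R b%:~R.
  have := JD _ _ _ _ (JZ a _ _ J1) (JZ b _ _ J01).
  by rewrite !mulr0 !mulr1 addr0 add0r.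
have J0 (w : int) : J (w%:~R / q%:R) 0 -> (q %| w)%Z.
  move=> Jw; apply/negPn/negP => /(coprimez_prime _ _ q_pr)[a [b ab1]].
  have J1q : J (1 / q%:R) 0.
    have := JD _ _ _ _ (JZ a _ _ Jw) (Jint b 0).
    rewrite mulr0 addr0.
    have -> // : a%:~R * (w%:~R / q%:R) + b%:~R = 1 / q%:R :> rat.
    have ab1Q : a%:~R * w%:~R + b%:~R * q%:R = 1 :> rat.
      have := congr1 (fun n : int => n%:~R : rat) ab1.
      by rewrite rmorphD !rmorphM.
    by rewrite -[X in _ = X / _]ab1Q; field.
  have := Jnorm _ _ J1q; rewrite mul1r invr_eq0 q_neq0 => /(_ isT).
  rewrite /qnorm mulr0 expr0n /= addr0 subr0 exprVn.
  rewrite ger0_norm ?invr_ge0 ?exprn_ge0 ?ler0n //.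
  rewrite invr_ge1 ?unitfE ?expf_neq0 // ?exprn_gt0 ?ltr0n -?natrX ?lern1; nia.
have [qv|qNv] := boolP (q %| v)%Z.
  apply/andP; split=> //; apply: J0.
  case/dvdzP: qv => k vE; move: Juv; rewrite vE.
  move/JD => /(_ _ _ (Jint 0 (- k))); rewrite addr0 rmorphM /= mulfK //.
  by rewrite rmorphN /= subrr.
exfalso; have [a [k akE]] := coprimez_prime _ _ q_pr qNv.
pose c := - a * u.
(* By the Bezout relation [a v + k q = 1], scaling by [- a] and subtracting [k e] brings the second
   coordinate to [- 1 / q]. *)
have Jc : J (c%:~R / q%:R) (- 1 / q%:R).
  have := JD _ _ _ _ (JZ (- a) _ _ Juv) (Jint 0 (- k)).
  rewrite addr0 mulrA -rmorphM /= -/c; congr (J _ _).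
  have akQ : a%:~R * v%:~R + k%:~R * q%:R = 1 :> rat.
    have := congr1 (fun n : int => n%:~R : rat) akE.
    by rewrite rmorphD !rmorphM.
  by rewrite -[X in _ = - X / _]akQ !rmorphN /=; field.
have [b /andP[bq cb]] : exists b : int,
    (`|2 * b - m%:Z| <= q%:Z) && (q %| b - c)%Z.
  (* For [b = c - k' q], the number [2 b - m + q] is the remainder of [r] modulo [2 q]. *)
  pose r := 2 * c - m%:Z + q%:Z; pose k' := (r %/ (2 * q%:Z))%Z.
  have r_ge : 0 <= (r %% (2 * q%:Z))%Z by apply: modz_ge0; lia.
  have r_lt : (r %% (2 * q%:Z))%Z < 2 * q%:Z by apply: ltz_pmod; lia.
  have rE := divz_eq r (2 * q%:Z); rewrite -/k' in rE.
  exists (c - k' * q%:Z); apply/andP; split; first by rewrite /r in rE; nia.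
  by rewrite [c - _]addrC addrK rpredN dvdz_mull.
have Jb : J (b%:~R / q%:R) (- 1 / q%:R).
  case/dvdzP: cb => l lE.
  have -> : b = c + l * q%:Z by rewrite -lE; ring.
  have := JD _ _ _ _ Jc (Jint l 0); rewrite addr0; congr (J _ _).
  by rewrite rmorphD rmorphM /= mulrDl mulfK.
pose f := 1 + m%:Z * b - b ^+ 2.
have qf : (q %| f)%Z.
  rewrite -[f]opprK rpredN; apply: J0.
  (* The product of [(b - e) / q] with the conjugate [b - m + e] is [- f / q]. *)
  have := JD _ _ _ _ (JZ (b - m%:Z) _ _ Jb) (Jeps _ _ Jb).
  congr (J _ _); rewrite /f; last by rewrite rmorphB /=; field.
  by rewrite !(rmorphN, rmorphB, rmorphD, rmorphM, rmorphXn, rmorph1) /=; field.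
have f_ge : q%:Z ^+ 2 <= `|f|.
  have := Jnorm _ _ Jb.
  have -> : qnorm m (b%:~R / q%:R) (- 1 / q%:R) = - (f%:~R / q%:R ^+ 2) :> rat.
    rewrite /f /qnorm !(rmorphB, rmorphD, rmorphM, rmorphXn, rmorph1) /=.
    by field.
  rewrite [- 1 / _ != 0]mulf_neq0 ?oppr_eq0 ?invr_eq0 // orbT => /(_ isT).
  rewrite normrN normrM normfV (ger0_norm (exprn_ge0 _ _)) //.
  rewrite ler_pdivlMr ?exprn_gt0 ?ltr0n ?prime_gt0 // mul1r.
  by rewrite -intr_norm -[q%:R]/(q%:Z%:~R) -rmorphXn ler_int.
apply: (nob q b) => //; rewrite -/f.
suff f_ge0 : 0 <= f by rewrite ger0_norm in f_ge.
(* A negative [f] would give [(2 b - m)^2 = m^2 + 4 - 4 f > 4 q^2], against the choice of [b]. *)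
rewrite leNgt; apply/negP => f_lt0; rewrite ltr0_norm // in f_ge.
rewrite /f in f_ge f_lt0.
have : (2 * b - m%:Z) ^+ 2 <= q%:Z ^+ 2 by nia.
by nia.
Qed.

(** Denominators are cleared one prime at a time: for [n = l q], multiplying by [q] leaves the
    denominator [l], induction makes both numerators multiples of [l], and
    [lattice_prime_denominator] disposes of [q]. *)
Lemma lattice_integral (m : nat) (J : rat -> rat -> Prop)
    (J1 : J 1 0)
    (JD : forall x y x' y', J x y -> J x' y' -> J (x + x') (y + y'))
    (JZ : forall (n : int) x y, J x y -> J (n%:~R * x) (n%:~R * y))
    (Jeps : forall x y, J x y -> J y (x + m%:R * y))
    (Jnorm : forall x y, J x y -> (x != 0) || (y != 0) ->
       1 <= `|qnorm m x y|)
    (nob : forall (q : nat) (b : int), prime q -> `|2 * b - m%:Z| <= q%:Z ->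
       (q %| 1 + m%:Z * b - b ^+ 2)%Z ->
       q%:Z ^+ 2 <= 1 + m%:Z * b - b ^+ 2 -> False)
    (x y : rat) :
  J x y -> exists u v : int, x = u%:~R /\ y = v%:~R.
Proof.
have cleared (n : nat) : (0 < n)%N -> forall u v : int,
    J (u%:~R / n%:R) (v%:~R / n%:R) -> (n %| u)%Z && (n %| v)%Z.
  have [k] := ubnP n; elim: k n => // k IHk n nk n_gt0 u v Juv.
  have [n_le1|n_gt1] := leqP n 1.
    by have -> : n = 1%N by [lia]; rewrite !dvd1z.
  have q_pr := pdiv_prime n_gt1; have /dvdnP[l nE] := pdiv_dvd n.
  set q := pdiv n in q_pr nE.
  have q_gt1 := prime_gt1 q_pr; have q_neq0 : q%:R != 0 :> rat.
    by rewrite pnatr_eq0; lia.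
  have l_gt0 : (0 < l)%N by lia.
  have l_neq0 : l%:R != 0 :> rat by rewrite pnatr_eq0; lia.
  have /(IHk l _ l_gt0)/andP[] : J (u%:~R / l%:R) (v%:~R / l%:R).
  - move: (JZ q _ _ Juv); rewrite nE natrM; congr (J _ _); by field; apply/andP.
  - by nia.
  case/dvdzP=> u' uE /dvdzP[v' vE].
  have /(lattice_prime_denominator m J J1 JD JZ Jeps Jnorm nob q u' v' q_pr) :
    J (u'%:~R / q%:R) (v'%:~R / q%:R).
  - move: Juv; rewrite nE uE vE natrM !rmorphM /=.
    by congr (J _ _); field; apply/andP.
  by rewrite nE uE vE PoszM ![_ * l%:Z]mulrC !dvdz_mul2l; lia.
move=> Jxy; pose n := (`|denq x| * `|denq y|)%N.
have dx := denq_gt0 x; have dy := denq_gt0 y.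
have xE : x = (numq x * denq y)%:~R / n%:R.
  rewrite -{1}[x]divq_num_den -[n%:R]/(n%:Z%:~R) PoszM !gtz0_abs //.
  by rewrite !rmorphM /=; field; rewrite !intr_eq0 !gt_eqF.
have yE : y = (numq y * denq x)%:~R / n%:R.
  rewrite -{1}[y]divq_num_den -[n%:R]/(n%:Z%:~R) PoszM !gtz0_abs //.
  by rewrite !rmorphM /=; field; rewrite !intr_eq0 !gt_eqF.
have n_gt0 : (0 < n)%N by rewrite muln_gt0; lia.
have n_neq0 : n%:R != 0 :> rat by rewrite pnatr_eq0; lia.
have /(cleared n n_gt0)/andP[] :
  J ((numq x * denq y)%:~R / n%:R) ((numq y * denq x)%:~R / n%:R).
  by rewrite -xE -yE.
move=> /dvdzP[u uE] /dvdzP[v vE]; exists u, v.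
by split; [rewrite xE uE|rewrite yE vE]; rewrite rmorphM /= mulfK.
Qed.

(** * The field in the basis [1, e] and its ring of integers *)

Lemma square_free_mul_sqr_int (d : nat) (r : rat) :
  square_free d -> d%:R * r ^+ 2 \is a Num.int -> r \is a Num.int.
Proof.
move=> sf_d /intrP[k kE]; have den_gt0 := denq_gt0 r.
have kEz : d%:Z * numq r ^+ 2 = k * denq r ^+ 2.
  apply/eqP; rewrite -(eqr_int rat) !rmorphM /= -kE -{3}[r]divq_num_den.
  by apply/eqP; field; rewrite intr_eq0 gt_eqF.
(* The denominator is prime to the numerator, so its square divides [d] itself. *)
have dvd_d : (`|denq r| ^ 2 %| d)%N.
  rewrite -(@Gauss_dvdl _ _ (`|numq r| ^ 2)%N); last first.
    by rewrite coprimeXl // coprimeXr // coprime_sym coprime_num_den.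
  apply/dvdnP; exists `|k|%N; move/(congr1 absz): kEz.
  by rewrite !expr2 !abszM -!mulnn.
have den1 : denq r = 1 by have := sf_d _ dvd_d; lia.
by apply/intrP; exists (numq r); rewrite -{1}[r]divq_num_den den1 divr1.
Qed.

(** The unit [e], of norm [-1] and conjugate [m - e]. *)
Definition qgen (m : nat) : algC := (m%:R + sqrtC (m ^ 2 + 4)%:R) / 2.

Definition qelt (m : nat) (x y : rat) : algC := ratr x + ratr y * qgen m.

Lemma qgen_sqr (m : nat) : qgen m ^+ 2 = m%:R * qgen m + 1.
Proof.
have := sqrtCK ((m ^ 2 + 4)%:R : algC); rewrite /qgen natrD natrX.
set s := sqrtC _ => sE; rewrite expr_div_n sqrrD sE.
by field.
Qed.

Lemma qeltD (m : nat) (x y x' y' : rat) :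
  qelt m x y + qelt m x' y' = qelt m (x + x') (y + y').
Proof. by rewrite /qelt !rmorphD /=; ring. Qed.

Lemma qeltM (m : nat) (x y x' y' : rat) :
  qelt m x y * qelt m x' y' =
  qelt m (x * x' + y * y') (x * y' + y * x' + m%:R * y * y').
Proof.
have gE := qgen_sqr m; rewrite /qelt !(rmorphD, rmorphM) /= ratr_nat.
rewrite [LHS](_ : _ = ratr x * ratr x' + (ratr x * ratr y' + ratr y * ratr x') *
  qgen m + ratr y * ratr y' * qgen m ^+ 2); last by ring.
by rewrite gE; ring.
Qed.

Lemma qeltN (m : nat) (x y : rat) : - qelt m x y = qelt m (- x) (- y).
Proof. by rewrite /qelt !rmorphN /=; ring. Qed.

Lemma qelt1 (m : nat) : qelt m 1 0 = 1.
Proof. by rewrite /qelt rmorph0 rmorph1 mul0r addr0. Qed.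

(** The second factor is the conjugate, obtained by [e -> m - e]; this identifies [qnorm] with the
    field norm. *)
Lemma qelt_conj (m : nat) (x y : rat) :
  qelt m x y * qelt m (x + m%:R * y) (- y) = ratr (qnorm m x y).
Proof.
rewrite qeltM [X in qelt _ _ X](_ : _ = 0); last by ring.
rewrite [X in qelt _ X _](_ : _ = qnorm m x y); last by rewrite /qnorm; ring.
by rewrite /qelt rmorph0 mul0r addr0.
Qed.

Lemma qnormM (R : comNzRingType) (m : nat) (x y x' y' : R) :
  qnorm m (x * x' + y * y') (x * y' + y * x' + m%:R * y * y') =
  qnorm m x y * qnorm m x' y'.
Proof. by rewrite /qnorm; ring. Qed.

Lemma qnorm_int (R : comNzRingType) (m : nat) (x y : int) :
  qnorm m x%:~R y%:~R = (qnorm m x y)%:~R :> R.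
Proof.
by rewrite /qnorm !(rmorphB, rmorphD, rmorphM, rmorphXn, rmorph_nat).
Qed.

Lemma quadratic_fieldP (m : nat) (z : algC) :
  quadratic_field (m ^ 2 + 4) z <-> exists x y : rat, z = qelt m x y.
Proof.
split=> [[a [b ->]]|[x [y ->]]].
  exists (a - m%:R * b), (2 * b).
  by rewrite /qelt /qgen rmorphB !rmorphM /= !ratr_nat; field.
exists (x + m%:R * y / 2), (y / 2).
by rewrite /qelt /qgen rmorphD !rmorphM /= fmorphV /= !ratr_nat; field.
Qed.

(** Four times the norm is [(2 x + m y)^2 - (m^2 + 4) y^2]. A nontrivial zero yields a rational [s]
    with [(m^2 + 4) s^2 = 1]; square-freeness makes [s] an integer, impossible as [m^2 + 4 >= 4]. *)
Lemma qnorm_neq0 (m : nat) (x y : rat) : square_free (m ^ 2 + 4) ->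
  (x != 0) || (y != 0) -> qnorm m x y != 0.
Proof.
move=> sf xy_neq0; apply/eqP => N0.
have sqE : (m ^ 2 + 4)%:R * y ^+ 2 = (2 * x + m%:R * y) ^+ 2 :> rat.
  rewrite -[RHS]subr0 -(mulr0 4) -N0 natrD natrX.
  by rewrite /qnorm; ring.
have d_neq0 : (m ^ 2 + 4)%:R != 0 :> rat by rewrite pnatr_eq0 addnS.
have [y0|y_neq0] := eqVneq y 0.
  move: xy_neq0 N0; rewrite y0 eqxx orbF => x_neq0.
  rewrite /qnorm mulr0 expr0n addr0 subr0.
  by move/eqP; rewrite sqrf_eq0 (negPf x_neq0).
have w_neq0 : 2 * x + m%:R * y != 0.
  by rewrite -sqrf_eq0 -sqE mulf_neq0 ?sqrf_eq0.
have s1 : (m ^ 2 + 4)%:R * (y / (2 * x + m%:R * y)) ^+ 2 = 1.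
  by rewrite expr_div_n mulrA sqE divff ?sqrf_eq0.
have /(square_free_mul_sqr_int _ _ sf)/intrP[k kE] :
  (m ^ 2 + 4)%:R * (y / (2 * x + m%:R * y)) ^+ 2 \is a Num.int.
  by rewrite s1 rpred1.
move: s1; rewrite kE -rmorphXn -[_%:R]/((m ^ 2 + 4)%:Z%:~R) -rmorphM /=.
move/eqP; rewrite -[1]/(1%:~R) eqr_int => /eqP.
have := sqr_ge0 k; move: (k ^+ 2) (m ^ 2)%N => j a j_ge0.
have [j_le0|j_gt0] := lerP j 0.
  by have -> : j = 0 by [lia]; rewrite mulr0.
by have : 4 * j <= (a + 4)%N%:Z * j by [nia]; lia.
Qed.

Lemma qelt_eq0 (m : nat) (x y : rat) : square_free (m ^ 2 + 4) ->
  (qelt m x y == 0) = (x == 0) && (y == 0).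
Proof.
move=> sf; apply/idP/andP => [/eqP z0|[/eqP-> /eqP->]]; last first.
  by rewrite /qelt rmorph0 mul0r addr0.
apply/andP; rewrite -[_ && _]negbK negb_and; apply/negP.
move=> /(qnorm_neq0 _ _ _ sf); have := qelt_conj m x y.
by rewrite z0 mul0r => /esym/eqP; rewrite fmorph_eq0 => ->.
Qed.

Lemma qelt_inj (m : nat) (x y x' y' : rat) : square_free (m ^ 2 + 4) ->
  qelt m x y = qelt m x' y' -> x = x' /\ y = y'.
Proof.
move=> sf /eqP; rewrite -subr_eq0 qeltN qeltD qelt_eq0 // !subr_eq0.
by case/andP => /eqP-> /eqP->.
Qed.

Lemma qgen_Aint (m : nat) : qgen m \in Aint.
Proof.
pose p : {poly algC} := 'X^2 - (m%:R *: 'X + 1).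
have size_p : (size (- (m%:R *: 'X + 1) : {poly algC}) <
   size ('X^2 : {poly algC}))%N.
  rewrite size_polyXn size_polyN (leq_ltn_trans (size_polyD _ _)) //.
  rewrite size_poly1 gtn_max andbT (leq_ltn_trans (size_scale_leq _ _)) //.
  by rewrite size_polyX.
apply: (@root_monic_Aint p).
- apply/rootP; rewrite /p; move: (qgen m) (qgen_sqr m) => g gE.
  by rewrite !hornerE gE subrr.
- by rewrite monicE lead_coefDl // lead_coefXn.
- apply/polyOverP => i; rewrite !coefE.
  by rewrite rpredB ?rpredD ?rpredM ?rpred_nat.
Qed.

(** For [y != 0] the minimal polynomial is [X^2 - t X + n], with [t] the trace and [n] the norm, and
    that of an algebraic integer has integer coefficients. *)
Lemma ring_of_integers_trace_norm (m : nat) (x y : rat) :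
  square_free (m ^ 2 + 4) -> qelt m x y \in Aint ->
  2 * x + m%:R * y \is a Num.int /\ qnorm m x y \is a Num.int.
Proof.
move=> sf zA; have [y0|y_neq0] := eqVneq y 0.
  have xz : x \is a Num.int.
    rewrite -Cint_rat; apply: Cint_rat_Aint; first exact: Crat_rat.
    by move: zA; rewrite y0 /qelt rmorph0 mul0r addr0.
  rewrite y0 /qnorm !mulr0 expr0n subr0 !addr0.
  by rewrite rpredM ?rpredX ?rpred_nat.
have [p [pE p_mon] p_dvd] := minCpolyP (qelt m x y).
move tdef : (2 * x + m%:R * y) => t; move ndef : (qnorm m x y) => n.
pose q : {poly rat} := 'X^2 - (t *: 'X - n%:P).
have size_q' : (size (- (t *: 'X - n%:P) : {poly rat}) <
   size ('X^2 : {poly rat}))%N.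
  rewrite size_polyXn size_polyN (leq_ltn_trans (size_polyD _ _)) //.
  rewrite size_polyN gtn_max.
  rewrite (leq_ltn_trans (size_scale_leq _ _)) ?size_polyX //.
  by rewrite (leq_ltn_trans (size_polyC_leq1 _)).
have size_q : size q = 3 by rewrite size_polyDl // size_polyXn.
have q_mon : q \is monic by rewrite monicE lead_coefDl // lead_coefXn.
have p_q : (p %| q).
  have tE : ratr t = qelt m x y + qelt m (x + m%:R * y) (- y).
    rewrite qeltD subrr /qelt rmorph0 mul0r addr0 -tdef; congr ratr; ring.
  have nE : ratr n = qelt m x y * qelt m (x + m%:R * y) (- y).
    by rewrite qelt_conj ndef.
  rewrite -p_dvd; apply/rootP; rewrite /q !(rmorphB, rmorphD, rmorphXn) /=.
  rewrite map_polyX map_polyZ map_polyX map_polyC.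
  move: (qelt m x y) (qelt _ _ _) tE nE => z c tE nE.
  by rewrite !hornerE /= tE nE; ring.
(* A linear [p] would make the element rational, against [y != 0]. *)
have size_p : size p = 3.
  apply/eqP; rewrite eqn_leq -{1}size_q dvdp_leq ?monic_neq0 //=.
  have : (1 < size p)%N.
    by have := size_minCpoly (qelt m x y); rewrite pE size_map_poly.
  rewrite leq_eqVlt => /orP[/eqP size_p|//].
  have /rootP : root (map_poly ratr p) (qelt m x y) by rewrite p_dvd dvdpp.
  rewrite horner_coef size_map_poly -size_p !big_ord_recl big_ord0 !coef_map /=.
  rewrite expr0 mulr1 addr0 expr1.
  have -> : p`_1 = 1 by have := monicP p_mon; rewrite lead_coefE -size_p.
  rewrite rmorph1 mul1r => /eqP; rewrite addrC addr_eq0 => /eqP zE.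
  have /(qelt_inj _ _ _ _ _ sf)[_ y0] : qelt m x y = qelt m (- p`_0) 0.
    by rewrite zE /qelt rmorph0 mul0r addr0 rmorphN.
  by rewrite y0 eqxx in y_neq0.
have pq : p = q.
  by apply/eqP; rewrite -eqp_monic // -dvdp_size_eqp // size_p size_q.
have := zA; rewrite /Aint unfold_in pE pq => /polyOverP cz.
have := cz 1%N; have := cz 0%N; rewrite !coef_map /= !Cint_rat /q !coefE /=.
by rewrite mulr1 mulr0 !sub0r subr0 opprK rpredN.
Qed.

(** Trace [t] and norm [n] satisfy [t^2 - 4 n = (m^2 + 4) y^2], so square-freeness makes [y] an
    integer [v]; then [x] is an integer because [t] and [m v] have the same parity. *)
Lemma ring_of_integersP (m : nat) (z : algC) : square_free (m ^ 2 + 4) ->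
  ring_of_integers (quadratic_field (m ^ 2 + 4)) z <->
  exists u v : int, z = qelt m u%:~R v%:~R.
Proof.
move=> sf; split=> [[/quadratic_fieldP[x [y ->]]]|[u [v ->]]]; last first.
  split; first by apply/quadratic_fieldP; exists u%:~R, v%:~R.
  rewrite /= /qelt !ratr_int.
  by apply: rpredD (Aint_int _) _; apply: rpredM (Aint_int _) (qgen_Aint _).
move=> /(ring_of_integers_trace_norm _ _ _ sf)[/intrP[t tE] /intrP[n nE]].
have dyE : t%:~R ^+ 2 - 4 * n%:~R = (m ^ 2 + 4)%:R * y ^+ 2 :> rat.
  by rewrite -tE -nE natrD natrX /qnorm; ring.
have /intrP[v vE] : y \is a Num.int.
  apply: (square_free_mul_sqr_int _ _ sf).
  by rewrite -dyE rpredB ?rpredX ?rpredM ?rpred_int ?rpred_nat.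
have eqz : t ^+ 2 - 4 * n = (m ^ 2 + 4)%N%:Z * v ^+ 2.
  apply/eqP; rewrite -(eqr_int rat) rmorphB !rmorphM /= -!expr2; apply/eqP.
  by rewrite dyE vE.
(* The squares of [t] and [m v] agree modulo 4. *)
have [w wE] : exists w : int, t = m%:Z * v + 2 * w.
  have aE := divz_eq (t - m%:Z * v) 2.
  have := ltz_pmod (t - m%:Z * v) (isT : 0 < 2 :> int).
  have := modz_ge0 (t - m%:Z * v) (isT : 2 != 0 :> int).
  move: (_ %/ _)%Z (_ %% _)%Z aE => w r aE r_ge0 r_lt2.
  have tw : t = m%:Z * v + 2 * w + r by lia.
  exists w; have [r0|r1] : r = 0 \/ r = 1 by [lia]; first by lia.
  move: eqz; rewrite tw r1 PoszD -mulnn PoszM => eqz.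
  have : 4 * (w ^+ 2 + w + m%:Z * v * w - n - v ^+ 2) + 2 * (m%:Z * v) + 1 = 0.
    apply/eqP; rewrite -subr_eq0 -(subrr ((m%:Z * m%:Z + 4) * v ^+ 2)) -{1}eqz.
    by apply/eqP; ring.
  by lia.
exists w, v; rewrite -vE; congr (qelt m _ _).
move: tE; rewrite wE rmorphD !rmorphM /= -vE => tE.
apply: (mulfI (_ : 2 != 0)) => //; apply: (addrI (m%:R * y)).
by rewrite addrC tE.
Qed.

(** * Class number one as principality of all fractional ideals *)

Lemma quadratic_field_mul (m : nat) (x y : algC) :
  quadratic_field (m ^ 2 + 4) x -> quadratic_field (m ^ 2 + 4) y ->
  quadratic_field (m ^ 2 + 4) (x * y).
Proof.
move=> /quadratic_fieldP[a [b ->]] /quadratic_fieldP[a' [b' ->]].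
by apply/quadratic_fieldP; rewrite qeltM; eexists; eexists.
Qed.

Lemma quadratic_field_inv (m : nat) (x : algC) : square_free (m ^ 2 + 4) ->
  quadratic_field (m ^ 2 + 4) x -> quadratic_field (m ^ 2 + 4) x^-1.
Proof.
move=> sf /quadratic_fieldP[a [b ->]]; apply/quadratic_fieldP.
have [->|ab_neq0] := eqVneq (qelt m a b) 0.
  by exists 0, 0; rewrite invr0 /qelt rmorph0 mul0r addr0.
have N_neq0 : qnorm m a b != 0.
  by apply: qnorm_neq0 => //; rewrite -negb_and -(qelt_eq0 m).
exists ((a + m%:R * b) / qnorm m a b), (- b / qnorm m a b).
apply: (mulfI ab_neq0); rewrite divff // qeltM -(qelt1 m).
by congr (qelt m _ _); move: N_neq0; rewrite /qnorm => N_neq0; field.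
Qed.

Lemma class_number_eq1P (K : set algC) :
    K 1 -> (forall x y, K x -> K y -> K (x * y)) ->
    (forall x, K x -> K x^-1) -> fractional_ideal K (ring_of_integers K) ->
  class_number K = 1%N <->
  forall I, fractional_ideal K I -> exists x,
    [/\ K x, x != 0 & I = [set x * y | y in ring_of_integers K]%classic].
Proof.
move=> K1 KM KV OI; split=> [cl1 I II|principal].
  have clI A : fractional_ideal K A -> class_group K (ideal_class K A).
    by move=> AI; exists A.
  have [C clE] : exists C, class_group K = [set C]%classic.
    move: cl1; rewrite /class_number => /eqP/cardfs1P[C CE]; exists C.
    have fin : finite_set (class_group K).
      (* For an infinite class group [fset_set] would be empty, hence would not contain [C]. *)
      apply: contrapT => inf; move/fsetP/(_ C): CE; rewrite in_fset1 eqxx.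
      by rewrite /fset_set; case: pselect => // _; rewrite in_fset0.
    by rewrite -(fset_setK fin) CE set_fset1.
  have := clI _ OI; have := clI _ II; rewrite clE /= => <- OIE.
  have [x [Kx x_neq0] xE] : ideal_class K (ring_of_integers K) I.
    rewrite OIE; exists 1; first by split; rewrite ?oner_neq0.
    by under eq_fun do rewrite mul1r; rewrite image_id.
  by exists x; split.
have clE : class_group K = [set ideal_class K (ring_of_integers K)]%classic.
  apply/seteqP; split=> [_ [I II <-]|_ ->]; last by exists (ring_of_integers K).
  have [x [Kx x_neq0 ->]] := principal I II.
  apply/seteqP; split=> _ [y [Ky y_neq0] <-].
    exists (y * x); first by split; rewrite ?mulf_neq0 //; exact: KM.
    by rewrite image_comp; apply: eq_imagel => z _ /=; rewrite mulrA.
  exists (y / x); first by split; rewrite ?mulf_neq0 ?invr_eq0 //; apply/KM/KV.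
  by rewrite image_comp; apply: eq_imagel => z _ /=; rewrite mulrA divfK.
by rewrite /class_number clE fset_set1 cardfs1.
Qed.

Lemma fractional_ideal_ring_of_integers (m : nat) : square_free (m ^ 2 + 4) ->
  fractional_ideal (quadratic_field (m ^ 2 + 4))
    (ring_of_integers (quadratic_field (m ^ 2 + 4))).
Proof.
move=> sf; have O1 : ring_of_integers (quadratic_field (m ^ 2 + 4)) 1.
  by apply/ring_of_integersP => //; exists 1, 0; rewrite qelt1.
split=> //.
- by move=> x [].
- by exists 1; rewrite ?oner_neq0.
- move=> x y /ring_of_integersP[//|u [v ->]] /ring_of_integersP[//|u' [v' ->]].
  apply/ring_of_integersP => //; exists (u + u'), (v + v').
  by rewrite qeltD !rmorphD.
- move=> x y [Kx Ax] [Ky Ay]; split; first exact: quadratic_field_mul.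
  by rewrite /= rpredM.
- by exists 1; split; rewrite ?oner_neq0 // => x Ox; rewrite mul1r.
Qed.

Lemma class_number1_principal (m : nat) : square_free (m ^ 2 + 4) ->
  h (m ^ 2 + 4) = 1%N <->
  forall I, fractional_ideal (quadratic_field (m ^ 2 + 4)) I -> exists x,
    [/\ quadratic_field (m ^ 2 + 4) x, x != 0 &
        I = [set x * y |
          y in ring_of_integers (quadratic_field (m ^ 2 + 4))]%classic].
Proof.
move=> sf; apply: class_number_eq1P.
- by apply/quadratic_fieldP; exists 1, 0; rewrite qelt1.
- exact: quadratic_field_mul.
- by move=> x; apply: quadratic_field_inv.
- exact: fractional_ideal_ring_of_integers.
Qed.

(** * The ideals [(q, t - e)] of prime index *)

Lemma qelt_intM (m : nat) (u v u' v' : int) :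
  qelt m u%:~R v%:~R * qelt m u'%:~R v'%:~R =
  qelt m (u * u' + v * v')%:~R (u * v' + v * u' + m%:R * v * v')%:~R.
Proof. by rewrite qeltM !(rmorphD, rmorphM, rmorph_nat). Qed.

Lemma qelt_int_inj (m : nat) (u v u' v' : int) : square_free (m ^ 2 + 4) ->
  qelt m u%:~R v%:~R = qelt m u'%:~R v'%:~R -> u = u' /\ v = v'.
Proof. by move=> sf /(qelt_inj _ _ _ _ _ sf)[/intr_inj-> /intr_inj->]. Qed.

(* The ideal [q Z + (t - qgen m) Z] has index [q]: membership of [a + b qgen m]
   is the congruence [q | a + b t]. *)
Definition root_ideal (m q : nat) (t : int) : set algC :=
  [set z | exists a b : int,
     z = qelt m a%:~R b%:~R /\ (q %| a + b * t)%Z]%classic.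

(** The ideal is the kernel of [e -> t] modulo [q], a ring morphism because [q] divides
    [t^2 - m t - 1]. *)
Lemma fractional_ideal_root_ideal (m q : nat) (t : int) :
  square_free (m ^ 2 + 4) -> prime q -> (q %| 1 + m%:Z * t - t ^+ 2)%Z ->
  fractional_ideal (quadratic_field (m ^ 2 + 4)) (root_ideal m q t).
Proof.
move=> sf q_pr qf; split.
- by move=> _ [a [b [-> _]]]; apply/quadratic_fieldP; exists a%:~R, b%:~R.
- exists (qelt m q%:Z%:~R 0%:~R).
    by exists q%:Z, 0; rewrite mul0r addr0 dvdzz.
  rewrite qelt_eq0 // eqxx andbT intr_eq0.
  by have := prime_gt0 q_pr; lia.
- move=> _ _ [a [b [-> qab]]] [a' [b' [-> qab']]].
  exists (a + a'), (b + b'); rewrite qeltD !rmorphD; split=> //.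
  by rewrite mulrDl addrACA rpredD.
- move=> _ _ /ring_of_integersP[//|u [v ->]] [a [b [-> qab]]].
  exists (u * a + v * b), (u * b + v * a + m%:Z * v * b).
  rewrite qeltM !(rmorphD, rmorphM) /=; split=> //.
  rewrite [X in (_ %| X)%Z](_ : _ = (u + v * t) * (a + b * t)
    + v * b * (1 + m%:Z * t - t ^+ 2)); last by ring.
  by rewrite rpredD ?dvdz_mull.
- exists 1; split; rewrite ?oner_neq0 //.
    by apply/ring_of_integersP => //; exists 1, 0; rewrite qelt1.
  move=> _ [a [b [-> _]]]; rewrite mul1r.
  by apply/ring_of_integersP => //; exists a, b.
Qed.

(** The norm of a generator [x] is [k q] with [k] dividing [q]. If [k] is a unit, [qnorm_prime_ge]
    applies. Otherwise [q / x] has norm 1 or -1, so the ideal would be generated by [q], yet it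
    contains [t - qgen m]. *)
Lemma root_ideal_principal_ge (m q : nat) (t : int) (x : algC) :
  square_free (m ^ 2 + 4) -> prime q -> (q %| 1 + m%:Z * t - t ^+ 2)%Z ->
  root_ideal m q t =
    [set x * y | y in ring_of_integers (quadratic_field (m ^ 2 + 4))]%classic ->
  (m <= q)%N.
Proof.
move=> sf q_pr qf IE; have q_gt1 := prime_gt1 q_pr.
have O1 : ring_of_integers (quadratic_field (m ^ 2 + 4)) 1.
  by apply/ring_of_integersP => //; exists 1, 0; rewrite qelt1.
have [a [b [xE qab]]] : root_ideal m q t x.
  by rewrite IE; exists 1; rewrite ?mulr1.
have : root_ideal m q t (qelt m q%:Z%:~R 0%:~R).
  by exists q%:Z, 0; rewrite mul0r addr0 dvdzz.
rewrite IE => -[_ /ring_of_integersP[//|c [e ->]]].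
rewrite xE qelt_intM => /(qelt_int_inj _ _ _ _ _ sf)[qE zE].
have : root_ideal m q t (qelt m t%:~R (-1)%:~R).
  by exists t, (-1); rewrite mulN1r subrr dvdz0.
rewrite IE => -[_ /ring_of_integersP[//|c' [e' ->]]].
rewrite xE qelt_intM => /(qelt_int_inj _ _ _ _ _ sf)[tE oE].
have NN : qnorm m a b * qnorm m c e = q%:Z ^+ 2.
  by rewrite -qnormM qE zE /qnorm; ring.
have /dvdzP[k kE] : (q %| qnorm m a b)%Z.
  (* Modulo [q] the norm form splits, with [a + b * t] as a factor. *)
  rewrite [X in (_ %| X)%Z](_ : _ = (a - t * b + m%:Z * b) * (a + b * t)
    - b ^+ 2 * (1 + m%:Z * t - t ^+ 2)); last by rewrite /qnorm; ring.
  by rewrite rpredB ?dvdz_mull.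
have q_neq0 : q%:Z != 0 by lia.
have kN : k * qnorm m c e = q%:Z.
  by apply: (mulIf q_neq0); rewrite mulrAC -kE NN.
have k_dvd : (`|k| %| q)%N.
  by apply/dvdnP; exists `|qnorm m c e|%N; rewrite -abszM mulrC kN.
case/primeP: q_pr (q_pr) => _ /(_ _ k_dvd)/orP[/eqP k1|/eqP kq] q_pr.
  apply: (@qnorm_prime_ge m q a b) => //.
  by rewrite kE; have [->|->] : k = 1 \/ k = -1 by [lia]; [left|right]; lia.
have N1 : qnorm m c e = 1 \/ qnorm m c e = -1.
  have [E|E] : k = q%:Z \/ k = - q%:Z by lia.
    by left; apply: (mulfI q_neq0); rewrite mulr1 -{2}kN E.
  by right; apply: (mulfI q_neq0); rewrite mulrN1 -{2}kN E mulNr opprK.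
suff : (q %| qnorm m c e)%Z.
  by rewrite dvdzE; case: N1 => -> /=; rewrite dvdn1; lia.
(* [y] and [y'] are the cofactors of [q] and [t - qgen m] over the generator
   [x], so [y * (t - qgen m) = q * y']. *)
have yE1 : c * t + e * -1 = q%:Z * c'.
  by rewrite -oE -tE -qE -[RHS]addr0 -(mulr0 e') -zE; ring.
have yE2 : e * t + (c + m%:R * e) * -1 = q%:Z * e'.
  rewrite -oE -tE -qE -[RHS]addr0 -(mulr0 (c' + m%:R * e')) -zE; ring.
(* Eliminating [t] between [yE1] and [yE2] leaves the norm of the cofactor. *)
apply/dvdzP; exists (e * c' - c * e').
rewrite mulrBl -!mulrA ![_ * q%:Z]mulrC -yE1 -yE2 /qnorm; ring.
Qed.

(** * Principality from an element of minimal norm *)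

Lemma principal_of_no_small_prime (m : nat) (I : set algC) :
    square_free (m ^ 2 + 4) ->
    (forall (q : nat) (b : int), prime q -> `|2 * b - m%:Z| <= q%:Z ->
       (q %| 1 + m%:Z * b - b ^+ 2)%Z ->
       q%:Z ^+ 2 <= 1 + m%:Z * b - b ^+ 2 -> False) ->
    fractional_ideal (quadratic_field (m ^ 2 + 4)) I ->
  exists x, [/\ quadratic_field (m ^ 2 + 4) x, x != 0 &
    I = [set x * y |
          y in ring_of_integers (quadratic_field (m ^ 2 + 4))]%classic].
Proof.
move=> sf nob [IK [z0 Iz0 z0_neq0] ID IM [c [Oc c_neq0 cI]]].
have cIE z : I z -> exists u v : int, c * z = qelt m u%:~R v%:~R.
  by move=> /cI /ring_of_integersP; apply.
(* The denominator [c] makes the norms of the [c z] integers, so one of least absolute value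
   exists. *)
pose P n := `[< exists z u v, [/\ I z, z != 0,
  c * z = qelt m u%:~R v%:~R & `|qnorm m u v|%N = n] >].
have exP : exists n, P n.
  have [u [v czE]] := cIE _ Iz0.
  by exists `|qnorm m u v|%N; apply/asboolP; exists z0, u, v.
case: (ex_minnP exP) => _ /asboolP[x [u [v [Ix x_neq0 cxE <-]]]] min_uv.
have Kx := IK _ Ix; exists x; split=> //.
have uv_neq0 : (u%:~R != 0 :> rat) || (v%:~R != 0 :> rat).
  by rewrite -negb_and -(qelt_eq0 m) // -cxE mulf_neq0.
have O_int (k l : int) :
    ring_of_integers (quadratic_field (m ^ 2 + 4)) (qelt m k%:~R l%:~R).
  by apply/ring_of_integersP => //; exists k, l.
have JintM (k l : int) a b : I (x * qelt m a b) ->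
    I (x * (qelt m k%:~R l%:~R * qelt m a b)).
  by move=> Jab; rewrite mulrCA; apply: IM.
(* [J] is [x^-1 I] in coordinates; the minimality of [x] yields the norm bound that
   [lattice_integral] asks for. *)
pose J a b := I (x * qelt m a b).
have Jint a b : J a b -> exists k l : int, a = k%:~R /\ b = l%:~R.
  apply: (@lattice_integral m J) => //.
  - by rewrite /J qelt1 mulr1.
  - by move=> a1 b1 a2 b2 J1 J2; rewrite /J -qeltD mulrDr; apply: ID.
  - move=> k a1 b1 /(JintM k 0); rewrite qeltM /J.
    by congr (I (x * qelt m _ _)); ring.
  - move=> a1 b1 /(JintM 0 1); rewrite qeltM /J.
    by congr (I (x * qelt m _ _)); ring.
  - move=> a1 b1 Jab ab_neq0.
    have [u' [v' czE]] := cIE _ Jab.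
    have NE : (qnorm m u' v')%:~R = (qnorm m u v)%:~R * qnorm m a1 b1 :> rat.
      move: (czE); rewrite mulrA cxE qeltM => /(qelt_inj _ _ _ _ _ sf)[uE vE].
      by rewrite -!qnorm_int -uE -vE qnormM.
    have uvN_neq0 : (qnorm m u v)%:~R != 0 :> rat.
      by rewrite -qnorm_int qnorm_neq0.
    have : (`|qnorm m u v| <= `|qnorm m u' v'|)%N.
      apply: min_uv; apply/asboolP; exists (x * qelt m a1 b1), u', v'.
      split=> //.
      by rewrite mulf_neq0 // qelt_eq0 // negb_and.
    rewrite -lez_nat !abszE -(ler_int rat) !intr_norm NE normrM.
    by rewrite ler_pMr ?normr_gt0.
apply/seteqP; split=> [z Iz|_ [y Oy <-]]; last by rewrite mulrC; apply: IM.
have /quadratic_fieldP[a [b zE]] : quadratic_field (m ^ 2 + 4) (x^-1 * z).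
  by apply: quadratic_field_mul; [apply: quadratic_field_inv|apply: IK].
have xzE : x * qelt m a b = z by rewrite -zE mulVKf.
have [k [l [aE bE]]] : exists k l : int, a = k%:~R /\ b = l%:~R.
  by apply: Jint; rewrite /J xzE.
by exists (qelt m a b) => //; rewrite aE bE.
Qed.

(** * The criterion by prime values *)

Lemma square_free_sqrD4_neq2 (m : nat) : square_free (m ^ 2 + 4) -> m != 2%N.
Proof. by move=> sf; apply/eqP => m2; have := sf 2; rewrite m2 => /(_ isT). Qed.

Lemma half_bound_rat (t : int) (p : nat) :
  (t%:~R <= (p%:R - 1) / 2%:R :> rat) = (2 * t <= p%:Z - 1).
Proof.
by rewrite ler_pdivlMr // -(ler_int rat) rmorphB rmorphM /= mulrC.
Qed.

Theorem theorem1p5 (m : nat) (hm : (0 < m)%N)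
    (hsf : square_free (m ^ 2 + 4)%N) :
  h (m ^ 2 + 4)%N = 1%N <->
  (m = 1%N \/
   exists p : nat,
     [/\ prime p, m = p &
       forall t : int, 1 <= t -> t%:~R <= (p%:R - 1) / 2%:R :> rat ->
         exists2 q : nat, prime q & 1 + p%:Z * t - t ^+ 2 = q%:Z]).
Proof.
rewrite class_number1_principal //; split=> [principal|prime_values].
  have [m1|m_neq1] := eqVneq m 1%N; [by left|right; exists m].
  have m_neq2 := square_free_sqrD4_neq2 _ hsf.
  have prime_value (t : int) : 1 <= t -> 2 * t <= m%:Z - 1 ->
      exists2 q : nat, prime q & 1 + m%:Z * t - t ^+ 2 = q%:Z.
    move=> t_ge1 t_le; have f_gt1 : 1 < 1 + m%:Z * t - t ^+ 2 by nia.
    have [n nE] : exists n : nat, 1 + m%:Z * t - t ^+ 2 = n%:Z.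
      by exists (absz (1 + m%:Z * t - t ^+ 2)%R); rewrite abszE gtr0_norm; lia.
    rewrite nE in f_gt1; exists n => //.
    have pn := pdiv_prime (f_gt1 : (1 < n)%N).
    have qf : (pdiv n %| 1 + m%:Z * t - t ^+ 2)%Z.
      by rewrite nE dvdzE pdiv_dvd.
    have [x [_ _ IE]] :=
      principal _ (fractional_ideal_root_ideal _ _ _ hsf pn qf).
    have le_m := root_ideal_principal_ge _ _ _ _ hsf pn qf IE.
    (* The least prime factor of [n] is at least [m], while [n < m^2]. *)
    by apply: ltn_pdiv2_prime; nia.
  split=> // [|t t_ge1]; last by rewrite half_bound_rat; apply: prime_value.
  (* The value at [t = 1] is [m], and [t = 1] is in range because [m >= 3]. *)
  have [||q q_pr qE] := prime_value 1; [by []|lia|].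
  by have -> : m = q by lia.
move=> I; apply: principal_of_no_small_prime => // q b q_pr b_near qf f_ge.
have q_gt1 := prime_gt1 q_pr.
have bE : (2 * b - m%:Z) ^+ 2 + 4 * (1 + m%:Z * b - b ^+ 2) = m%:Z ^+ 2 + 4.
  by ring.
case: prime_values => [m1|[p [p_pr mp prime_value]]].
  (* For [m = 1], [bE] gives [4 q^2 <= 5], impossible for [q >= 2]. *)
  by have := sqr_ge0 (2 * b - m%:Z); rewrite m1 in bE *; nia.
rewrite -mp in p_pr prime_value.
have q_lt_m : q%:Z < m%:Z.
  by have := sqr_ge0 (2 * b - m%:Z); have := prime_gt1 p_pr; nia.
have m_neq2 := square_free_sqrD4_neq2 _ hsf.
have m_odd : odd m by case: (even_prime p_pr) => // m2; rewrite m2 in m_neq2.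
(* The reflection [b -> m - b] preserves the value. From [|2 b - m| <= q < m] both [b] and [m - b]
   are positive, and [m] odd excludes [2 b = m]. *)
have [t [t_ge1 t_le fE]] : exists t : int, [/\ 1 <= t, 2 * t <= m%:Z - 1 &
    1 + m%:Z * b - b ^+ 2 = 1 + m%:Z * t - t ^+ 2].
  have [le_b|lt_b] := lerP (2 * b) m%:Z; [exists b|exists (m%:Z - b)];
    by split; try lia; ring.
have [|q' q'_pr q'E] := prime_value t t_ge1; first by rewrite half_bound_rat.
(* The prime value [q'] is divisible by [q], hence equal to it, but is at least [q^2]. *)
rewrite fE q'E in qf f_ge; move: qf.
rewrite dvdzE /= dvdn_prime2 // => /eqP qq'.
move: f_ge q_gt1; rewrite -qq'; clear; nia.
Qed.
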